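(* Let $X,Y\in\mathcal L^2$ have different distributions and suppose $|\mathrm{Supp}(Y)|>2$. Then $(X,Y)\in\mathrm{IC}$ if and only if $(X,Y)\in\mathrm{IC}_0$.
   Context: All random variables live on an atomless probability space. $\mathcal L^2$ denotes the set of non-degenerate real random variables with finite variance. A function $g:\mathbb R\to\mathbb R$ is admissible for $(X,Y)$ if it is measurable and $g(X),g(Y)\in\mathcal L^2$. For $r\in[-1,1]$, $(X,Y)\in\mathrm{IC}_r$ means $X,Y\in\mathcal L^2$ and $\mathrm{Corr}(X,Y)=\mathrm{Corr}(g(X),g(Y))=r$ for all admissible $g$; $\mathrm{IC}=\bigcup_{r\in[-1,1]}\mathrm{IC}_r$. The support of a random variable $X$ is $\mathrm{Supp}(X)=\{x\in\mathbb R:\mathbb P(x-\epsilon<X\le x+\epsilon)>0\text{ for all }\epsilon>0\}$, and $|\cdot|$ denotes cardinality. *)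

(* Defs.v *)
From HB Require Import structures.
From mathcomp Require Import all_boot all_order all_algebra.
From mathcomp Require Import all_classical all_reals all_analysis.
Set Implicit Arguments. Unset Strict Implicit. Unset Printing Implicit Defensive.
Import Order.TTheory GRing.Theory Num.Theory.
Import numFieldNormedType.Exports.
Local Open Scope classical_set_scope.
Local Open Scope ring_scope.

Section defs.
Context d (T : measurableType d) (R : realType) (P : probability T R).

Definition atomless : Prop :=
  forall A : set T, measurable A -> (0 < P A)%E ->
    exists B : set T, [/\ measurable B, B `<=` A, (0 < P B)%E & (P B < P A)%E].

Definition nondegenerate (X : T -> R) : Prop :=
  forall c : R, P [set w | X w = c] <> 1%E.

Definition L2 (X : T -> R) : Prop :=
  X \in Lfun P 2%:E /\ nondegenerate X.

Definition Corr (X Y : T -> R) : R :=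
  fine (covariance P X Y) / Num.sqrt (fine 'V_P[X] * fine 'V_P[Y]).

Definition admissible (g : R -> R) (X Y : T -> R) : Prop :=
  [/\ measurable_fun setT g, L2 (g \o X) & L2 (g \o Y)].

Definition IC_r (r : R) (X Y : T -> R) : Prop :=
  [/\ L2 X, L2 Y, Corr X Y = r &
      forall g : R -> R, admissible g X Y -> Corr (g \o X) (g \o Y) = r].

Definition IC (X Y : T -> R) : Prop :=
  exists r : R, -1 <= r <= 1 /\ IC_r r X Y.

Definition Supp (Y : T -> R) : set R :=
  [set x | forall e : R, 0 < e -> (0 < P [set w | (x - e < Y w <= x + e)%R])%E].

Definition diff_distr (X Y : T -> R) : Prop :=
  exists A : set R, measurable A /\ P (X @^-1` A) <> P (Y @^-1` A).

Definition card_gt2 (S : set R) : Prop :=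
  exists a b c : R, [/\ S a, S b, S c & [/\ a <> b, b <> c & a <> c]].

End defs.

(* Main.v *)
Require Import Defs.
From HB Require Import structures.
From mathcomp Require Import all_boot all_order all_algebra.
From mathcomp Require Import all_classical all_reals all_analysis.
From mathcomp Require Import measurable_realfun ring lra.
Import Order.TTheory GRing.Theory Num.Theory.
Local Open Scope ring_scope.

(* Test the hypothesis on [g = 1_A + t 1_B] with [A], [B] disjoint. If [p] and
   [q] are the laws of [X] and [Y], the variances of [g X] and [g Y] are
   quadratics [Vp(t)], [Vq(t)] in the cell masses, and [r^2 Vp Vq] is the square
   of the quadratic [Cov(g X, g Y)]. When [q] charges [A], [B] and the complement
   of [A U B], [Vq] has no real root, so for [r <> 0] this forces [Vp] to be
   proportional to [Vq], whence [p = q] on the three cells unless [p] puts mass 1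
   on one of them. The support hypothesis provides such cells and nondegeneracy
   of [X] excludes concentration; splitting the cells further gives [p = q]. *)

(** * Algebra of quadratics and of three-cell distributions *)

Lemma quad_sqr_prop (F : realFieldType) (k a0 a1 a2 b0 b1 b2 s0 s1 s2 : F) :
  k != 0 -> 0 < b2 -> b1 ^+ 2 < 4 * b0 * b2 ->
  (forall t, (s0 + s1 * t + s2 * t ^+ 2) ^+ 2 =
     k * (a0 + a1 * t + a2 * t ^+ 2) * (b0 + b1 * t + b2 * t ^+ 2)) ->
  exists l, [/\ a0 = l * b0, a1 = l * b1 & a2 = l * b2].
Proof.
move=> k0 b2_gt0 disc S.
have b2_neq0 : b2 != 0 by rewrite gt_eqF.
(* Write [s], [a], [b] for the three quadratics. Cancelling the leading term of [s] leaves
   [u = s - l * b] of degree at most one, and [u ^+ 2 = c * b] with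
   [c = k * a - 2 * l * s + l ^+ 2 * b]. *)
pose l := s2 / b2.
pose u0 := s0 - l * b0; pose u1 := s1 - l * b1.
have s2E : s2 = l * b2 by rewrite /l divfK.
pose c0 := k * a0 - 2 * l * s0 + l ^+ 2 * b0.
pose c1 := k * a1 - 2 * l * s1 + l ^+ 2 * b1.
pose c2 := k * a2 - 2 * l * s2 + l ^+ 2 * b2.
have U t : (u0 + u1 * t) ^+ 2 =
    (c0 + c1 * t + c2 * t ^+ 2) * (b0 + b1 * t + b2 * t ^+ 2).
  have -> : u0 + u1 * t = (s0 + s1 * t + s2 * t ^+ 2)
      - l * (b0 + b1 * t + b2 * t ^+ 2) by rewrite /u0 /u1 s2E; ring.
  by rewrite sqrrB S /c0 /c1 /c2; ring.
(* Five evaluations determine a polynomial of degree at most four, so linear arithmetic recovers its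
   coefficients; those of degrees 4 and 3 kill [c2] and [c1]. *)
have U0 := U 0; have U1 := U 1; have U1' := U (-1); have U2 := U 2.
have U2' := U (-2).
have e0 : u0 ^+ 2 = c0 * b0 by move: U0; rewrite !expr2; lra.
have e4 : c2 * b2 = 0 by rewrite !expr2 in e0 U1 U1' U2 U2'; lra.
have c20 : c2 = 0.
  by move/eqP: e4; rewrite mulf_eq0 (negPf b2_neq0) orbF => /eqP.
rewrite c20 in U1 U1' U2 U2'.
have e3 : c1 * b2 = 0 by rewrite !expr2 in e0 U1 U1' U2 U2'; lra.
have c10 : c1 = 0.
  by move/eqP: e3; rewrite mulf_eq0 (negPf b2_neq0) orbF => /eqP.
rewrite c10 in U1 U1' U2 U2'.
have e1 : 2 * u0 * u1 = c0 * b1 by rewrite !expr2 in e0 U1 U1' U2 U2'; lra.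
have e2 : u1 ^+ 2 = c0 * b2 by rewrite !expr2 in e0 U1 U1' U2 U2' *; lra.
(* The square of an affine polynomial has zero discriminant, while that of [b] is negative, so the
   constant [c0] linking them vanishes. *)
have c0sq : c0 ^+ 2 * (4 * b0 * b2 - b1 ^+ 2) = 0.
  have -> : c0 ^+ 2 * (4 * b0 * b2 - b1 ^+ 2) =
    4 * (c0 * b0) * (c0 * b2) - (c0 * b1) ^+ 2 by ring.
  by rewrite -e0 -e1 -e2; ring.
have c00 : c0 = 0.
  move/eqP: c0sq; rewrite mulf_eq0 sqrf_eq0 => /orP[/eqP//|].
  by rewrite gt_eqF// subr_gt0.
have u00 : u0 = 0 by apply/eqP; rewrite -sqrf_eq0 e0 c00 mul0r.
have u10 : u1 = 0 by apply/eqP; rewrite -sqrf_eq0 e2 c00 mul0r.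
have s0E : s0 = l * b0 by apply/eqP; rewrite -subr_eq0 -/u0 u00.
have s1E : s1 = l * b1 by apply/eqP; rewrite -subr_eq0 -/u1 u10.
(* Now [c = 0] and [s = l * b], hence [k * a = 2 * l * s - l ^+ 2 * b = l ^+ 2 * b]. *)
exists (l ^+ 2 / k).
by split; apply: (mulfI k0);
   rewrite mulrA [k * (_ / _)]mulrC divfK//;
   apply/eqP; rewrite -subr_eq0; apply/eqP;
   [rewrite -c00 /c0 s0E|rewrite -c10 /c1 s1E|rewrite -c20 /c2 s2E]; ring.
Qed.

(** The products are, up to sign, covariances of cell indicators. If [l] is nonzero, cancellation
    makes the three ratios of [p] to [q] equal, and equal totals make them 1. If [l = 0], two of the
    [p] masses vanish and the third would be 1. *)
Lemma products_prop_eq (F : realFieldType) (l p1 p2 p3 q1 q2 q3 : F) :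
  p1 + p2 + p3 = 1 -> q1 + q2 + q3 = 1 ->
  0 < q1 -> 0 < q2 -> 0 < q3 -> p1 != 1 -> p2 != 1 -> p3 != 1 ->
  p1 * p2 = l * (q1 * q2) -> p1 * p3 = l * (q1 * q3) ->
  p2 * p3 = l * (q2 * q3) ->
  p1 = q1 /\ p2 = q2.
Proof.
move=> sp sq q1_gt0 q2_gt0 q3_gt0 p1n p2n p3n e12 e13 e23.
have [l0|l0] := eqVneq l 0.
  exfalso; move: e12 e13 e23; rewrite l0 !mul0r => /eqP + /eqP + /eqP.
  rewrite !mulf_eq0 => /orP[]/eqP z1 /orP[]/eqP z2 /orP[]/eqP z3;
    move: sp; rewrite ?z1 ?z2 ?z3 ?(add0r, addr0) => sp;
    by rewrite ?sp ?eqxx ?z1 ?z2 ?z3 ?sp ?eqxx// in p1n p2n p3n *;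
       move/eqP: sp; rewrite eq_sym oner_eq0.
have ne x y : 0 < x -> 0 < y -> l * (x * y) != 0.
  by move=> x0 y0; rewrite mulf_neq0// gt_eqF// mulr_gt0.
have := ne _ _ q1_gt0 q2_gt0; rewrite -e12 mulf_eq0 negb_or => /andP[p10 p20].
have := ne _ _ q1_gt0 q3_gt0; rewrite -e13 mulf_eq0 negb_or => /andP[_ p30].
have h23 : p2 * q3 = p3 * q2.
  by apply: (mulfI p10); rewrite !mulrA e12 e13; ring.
have h13 : p1 * q3 = p3 * q1.
  by apply: (mulfI p20); rewrite !mulrA [p2 * p1]mulrC e12 e23; ring.
have h12 : p1 * q2 = p2 * q1.
  by apply: (mulfI p30); rewrite !mulrA ![p3 * _]mulrC e13 e23; ring.
split.
  rewrite -[LHS]mulr1 -sq -[RHS]mulr1 -sp !mulrDr h12 h13; ring.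
rewrite -[LHS]mulr1 -sq -[RHS]mulr1 -sp !mulrDr h23 -h12; ring.
Qed.

(** * Square-integrable variables, variance and correlation *)

Section random_variables.
Set Implicit Arguments.
Unset Strict Implicit.
Local Open Scope classical_set_scope.
Context d (T : measurableType d) (R : realType) (P : probability T R).
Implicit Types U V X Y Z : T -> R.

Let Pfin : P [set: T] \is a fin_num := fin_num_measure P _ measurableT.

Lemma indic_Lfun E (r : R) : 1 <= r -> measurable E ->
  (\1_E : T -> R) \in Lfun P r%:E.
Proof.
move=> r1 mE; rewrite inE; apply/andP; split; rewrite inE/=.
  exact: measurable_indic.
have r0 : r != 0 by rewrite gt_eqF// (lt_le_trans ltr01).
rewrite /finite_norm unlock poweR_lty//.
rewrite (eq_integral (EFin \o \1_E)); last first.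
  move=> x _ /=; rewrite indicE; congr EFin.
  by case: (x \in E); rewrite ?normr1 ?powR1// normr0 powR0.
by rewrite integral_indic// setIT ltey_eq fin_num_measure.
Qed.

Lemma LfunD (r : \bar R) U V : (1 <= r)%E ->
  U \in Lfun P r -> V \in Lfun P r -> U \+ V \in Lfun P r.
Proof. by move=> r1; apply: (Lfun_addr_closed P r1).2. Qed.

Lemma prob1_ae U (c : R) : measurable_fun setT U ->
  P [set w | U w = c] = 1%E <-> ae_eq P setT (EFin \o U) (cst c%:E).
Proof.
move=> mU.
have mE : measurable [set w | U w = c].
  rewrite -[X in measurable X]setTI; exact: (mU measurableT [set c]).
split=> [PE|[N [mN N0 sub]]].
  exists (~` [set w | U w = c]); split; first exact: measurableC.
    by apply: (eq_trans (probability_setC P mE)); rewrite PE subee.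
  by move=> w /= nUc Uc; apply: nUc => _ /=; rewrite Uc.
rewrite -[X in P X]setCK probability_setC; last exact: measurableC.
rewrite (_ : P (~` _) = 0)%E ?sube0//; apply: (subset_measure0 _ _ _ N0) => //.
  exact: measurableC.
by move=> w /= nUc; apply: sub => /= /(_ Logic.I) [].
Qed.

Lemma Lfun_measurable U (r : \bar R) : U \in Lfun P r -> measurable_fun setT U.
Proof. by rewrite inE => /andP[]; rewrite inE. Qed.

(** [Z] agrees almost everywhere with its absolute value, whose integral is therefore 0. *)
Lemma expectation_eq0_prob1 Z : Z \in Lfun P 1 -> 'E_P[Z]%E = 0%E ->
  P [set w | Z w < 0] = 0%E -> P [set w | Z w = 0] = 1%E.
Proof.
move=> Z1 EZ Zneg; have mZ := Lfun_measurable Z1.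
have mEZ : measurable_fun setT (EFin \o Z) by exact/measurable_EFinP.
apply/prob1_ae => //; apply/ae_eq_integral_abs => //.
rewrite -EZ unlock; apply: ae_eq_integral => //; first exact: measurableT_comp.
exists [set w | Z w < 0]; split => //.
  rewrite -[X in measurable X]setTI.
  have -> : [set w | Z w < 0] = Z @^-1` `]-oo, 0[.
    by apply/seteqP; split=> w /=; rewrite in_itv.
  exact: mZ.
move=> w /= nZ; rewrite ltNge; apply/negP => Z0; apply: nZ => _.
by rewrite /= ger0_norm.
Qed.

Lemma variance_neq0_nondegenerate U : U \in Lfun P 2%:E ->
  variance P U <> 0%E -> Defs.nondegenerate P U.
Proof.
move=> U2 VU c /prob1_ae Uc; apply: VU.
have mU := Lfun_measurable U2; have {}Uc := Uc mU.
have EU : 'E_P[U]%E = c%:E.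
  rewrite unlock (ae_eq_integral (cst c%:E))//; last exact/measurable_EFinP.
  by rewrite integral_cst//= probability_setT mule1.
rewrite /variance unlock EU unlock (ae_eq_integral (cst 0%E))//.
- by rewrite integral0.
- by apply/measurable_EFinP; apply: measurable_funM; apply: measurable_funB.
- apply: filterS Uc => w /= /(_ Logic.I) [Uw] _.
  by rewrite !fctE /= Uw subrr mulr0.
Qed.

(** Cauchy-Schwarz for [U] and for [- U] bounds the covariance by 0 from both sides. *)
Lemma covariance0 U V : U \in Lfun P 2%:E -> V \in Lfun P 2%:E ->
  variance P U = 0%E -> covariance P U V = 0%E.
Proof.
move=> U2 V2 VU0; apply/eqP; rewrite eq_le; apply/andP; split.
  by rewrite (le_trans (covariance_le U2 V2))// VU0 sqrte0 mul0e.
have NU2 : (\- U)%R \in Lfun P 2%:E by rewrite rpredN.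
have U1 := Lfun_subset12 Pfin U2; have V1 := Lfun_subset12 Pfin V2.
have := covariance_le NU2 V2.
by rewrite varianceN// VU0 sqrte0 mul0e covarianceNl ?Lfun2_mul_Lfun1//
  oppe_le0.
Qed.

(** Squaring and clearing the denominator makes the identity polynomial. It survives a vanishing
    variance, where both sides are 0, so it can be used without checking that the variables are
    nondegenerate. *)
Lemma Corr_eqM r U V : U \in Lfun P 2%:E -> V \in Lfun P 2%:E ->
  (Defs.nondegenerate P U -> Defs.nondegenerate P V -> Corr P U V = r) ->
  (fine (covariance P U V)) ^+ 2 =
    r ^+ 2 * (fine (variance P U) * fine (variance P V)).
Proof.
move=> U2 V2 CorrE.
have [VU0|/eqP VU0] := eqVneq (variance P U) 0%E.
  by rewrite covariance0// VU0/= mul0r mulr0 expr0n.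
have [VV0|/eqP VV0] := eqVneq (variance P V) 0%E.
  by rewrite covarianceC covariance0// VV0/= !mulr0 expr0n.
have {CorrE} := CorrE (variance_neq0_nondegenerate U2 VU0)
  (variance_neq0_nondegenerate V2 VV0).
have gt0 W : W \in Lfun P 2%:E -> variance P W <> 0%E ->
    0 < fine (variance P W).
  move=> W2 /eqP W0; rewrite lt_neqAle fine_ge0 ?variance_ge0// andbT eq_sym.
  by rewrite fine_eq0 ?variance_fin_num.
have VUV : 0 < fine (variance P U) * fine (variance P V).
  by rewrite mulr_gt0 ?gt0.
rewrite /Corr => <-; rewrite expr_div_n sqr_sqrtr ?ltW// divfK// gt_eqF//.
Qed.

(** * Laws as real-valued set functions, and covariances of indicators *)

Definition law X (A : set R) : R := fine (P (X @^-1` A)).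

Definition cov_indic E F : R :=
  fine (P (E `&` F)) - fine (P E) * fine (P F).

Lemma covariance_indic E F : measurable E -> measurable F ->
  covariance P (\1_E) (\1_F) = (cov_indic E F)%:E.
Proof.
move=> mE mF.
have E2 := indic_Lfun (ler1n R 2) mE; have F2 := indic_Lfun (ler1n R 2) mF.
have E1 := Lfun_subset12 Pfin E2; have F1 := Lfun_subset12 Pfin F2.
rewrite covarianceE ?Lfun2_mul_Lfun1//.
have -> : (\1_E * \1_F : T -> R) = \1_(E `&` F) by rewrite indicI.
rewrite !expectation_indic//; last exact: measurableI.
rewrite /cov_indic EFinB EFinM !fineK ?fin_num_measure//.
exact: measurableI.
Qed.

Lemma covariance_indic2 E1 E2 F1 F2 (t : R) :
    measurable E1 -> measurable E2 -> measurable F1 -> measurable F2 ->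
  fine (covariance P (\1_E1 \+ t \o* \1_E2) (\1_F1 \+ t \o* \1_F2)) =
  cov_indic E1 F1 + (cov_indic E1 F2 + cov_indic E2 F1) * t
    + cov_indic E2 F2 * t ^+ 2.
Proof.
move=> mE1 mE2 mF1 mF2.
have L2 E : measurable E -> (\1_E : T -> R) \in Lfun P 2%:E.
  exact/indic_Lfun/ler1n.
have L2t E : measurable E -> (t \o* \1_E : T -> R) \in Lfun P 2%:E.
  by move=> mE; rewrite Lfun_scale ?ler1n ?L2.
have L1 := Lfun_subset12 Pfin.
have L2D U V : U \in Lfun P 2%:E -> V \in Lfun P 2%:E ->
  U \+ V \in Lfun P 2%:E by apply: LfunD; rewrite lee1n.
rewrite covarianceDl ?covarianceDr ?L2 ?L2t ?L2D ?L2 ?L2t//.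
have Zl U E : U \in Lfun P 2%:E -> measurable E ->
    covariance P (t \o* \1_E) U = (t%:E * covariance P (\1_E) U)%E.
  move=> U2 mE; apply: covarianceZl; [exact/L1/L2|exact: L1|].
  by apply: Lfun2_mul_Lfun1; rewrite ?L2.
rewrite !Zl ?L2 ?L2t// ![covariance P _ (t \o* _)]covarianceC !Zl ?L2//.
rewrite ![covariance P (\1_F2) _]covarianceC.
rewrite !covariance_indic// -!EFinM -!EFinD/=; ring.
Qed.

Lemma law_ge0 X A : 0 <= law X A.
Proof. exact: fine_ge0. Qed.

Lemma preim_measurable X A : measurable_fun setT X -> measurable A ->
  measurable (X @^-1` A).
Proof. by move=> mX mA; rewrite -[X in measurable X]setTI; exact: mX. Qed.

Lemma lawE X A : measurable_fun setT X -> measurable A ->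
  (law X A)%:E = P (X @^-1` A).
Proof.
move=> mX mA; rewrite /law fineK// fin_num_measure//.
exact: preim_measurable.
Qed.

Lemma lawU X A B : measurable_fun setT X -> measurable A -> measurable B ->
  A `&` B = set0 -> law X (A `|` B) = law X A + law X B.
Proof.
move=> mX mA mB AB0; apply: EFin_inj.
rewrite EFinD !lawE//; last exact: measurableU.
rewrite preimage_setU measureU//; try exact: preim_measurable.
by rewrite -preimage_setI AB0 preimage_set0.
Qed.

Lemma lawC X A : measurable_fun setT X -> measurable A ->
  law X (~` A) = 1 - law X A.
Proof.
move=> mX mA; apply: EFin_inj.
rewrite EFinB !lawE//; last exact: measurableC.
by rewrite preimage_setC probability_setC//; exact: preim_measurable.
Qed.

Lemma law_split X A B : measurable_fun setT X -> measurable A -> measurable B ->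
  law X A = law X (A `&` B) + law X (A `\` B).
Proof.
move=> mX mA mB; rewrite -lawU//.
- by rewrite setUIDK.
- exact: measurableI.
- exact: measurableD.
- by rewrite setIACA setICr setI0.
Qed.

Lemma law_le X A B : measurable_fun setT X -> measurable A -> measurable B ->
  A `<=` B -> law X A <= law X B.
Proof.
move=> mX mA mB AB; rewrite (law_split mX mB mA) setIidr//.
by rewrite lerDl law_ge0.
Qed.

(** * Test functions and the resulting identity between quadratics *)

Lemma IC_r_sym r X Y : IC_r P r X Y -> IC_r P r Y X.
Proof.
have CorrC U V : Corr P U V = Corr P V U.
  by rewrite /Corr covarianceC mulrC [X in Num.sqrt X]mulrC mulrC.
move=> [X2 Y2 rXY rg]; split=> //; first by rewrite CorrC.
by move=> g [mg gY gX]; rewrite CorrC; exact: rg.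
Qed.

(** Variance of [1_A + t 1_B] for disjoint events [A], [B] of probabilities [a], [b]. *)
Definition var_form (a b t : R) : R :=
  a * (1 - a) + - 2 * a * b * t + b * (1 - b) * t ^+ 2.

(** The left side is the squared covariance of [g X] and [g Y] for [g = 1_A + t 1_B], with
    coefficients made of covariances of indicators. By [Corr_eqM] the identity holds at every [t],
    even where [g X] or [g Y] degenerates. *)
Lemma IC_r_quad r X Y A B : IC_r P r X Y -> measurable A -> measurable B ->
  A `&` B = set0 -> exists s0 s1 s2, forall t,
    (s0 + s1 * t + s2 * t ^+ 2) ^+ 2 =
    r ^+ 2 * (var_form (law X A) (law X B) t * var_form (law Y A) (law Y B) t).
Proof.
move=> [[X2 _] [Y2 _] _ rg] mA mB AB0.
have mX := Lfun_measurable X2; have mY := Lfun_measurable Y2.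
pose S E F := cov_indic (X @^-1` E) (Y @^-1` F).
exists (S A A), (S A B + S B A), (S B B) => t.
pose g : R -> R := \1_A \+ t \o* \1_B.
have gE Z : g \o Z = \1_(Z @^-1` A) \+ t \o* \1_(Z @^-1` B) by [].
have mg : measurable_fun setT g.
  apply: measurable_funD; first exact: measurable_indic.
  by apply: measurable_funM => //; exact: measurable_indic.
have Lg Z : measurable_fun setT Z -> g \o Z \in Lfun P 2%:E.
  move=> mZ; rewrite gE; apply: LfunD; rewrite ?lee1n// ?Lfun_scale ?ler1n//;
    by rewrite indic_Lfun ?ler1n//; exact: preim_measurable.
have varE Z : measurable_fun setT Z ->
    fine (variance P (g \o Z)) = var_form (law Z A) (law Z B) t.
  move=> mZ; rewrite gE /variance covariance_indic2//;
    try exact: preim_measurable.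
  have ZAB0 : Z @^-1` A `&` Z @^-1` B = set0.
    by rewrite -preimage_setI AB0 preimage_set0.
  rewrite /cov_indic !setIid [Z @^-1` B `&` _]setIC ZAB0 measure0.
  rewrite /var_form /law /=; ring.
rewrite -!varE// -Corr_eqM ?Lg//; last first.
  by move=> gX gY; apply: rg; split=> //; split=> //; exact: Lg.
by rewrite !gE covariance_indic2//; exact: preim_measurable.
Qed.

(* [lra] fails on contexts containing equalities between sets. *)
Local Ltac lra_clear :=
  repeat match goal with H : @eq (set _) _ _ |- _ => clear H end; lra.

(** * Equality of the two laws when [r] is nonzero *)

Section identical_laws.
Variables (r : R) (r0 : r != 0).

(** The third cell is the complement of the other two. The last three inequalities say that [X] is
    not concentrated on any one of the three cells. *)
Lemma law_eq_cells X Y A B : IC_r P r X Y -> measurable A -> measurable B ->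
  A `&` B = set0 ->
  0 < law Y A -> 0 < law Y B -> law Y A + law Y B < 1 ->
  law X A < 1 -> law X B < 1 -> 0 < law X A + law X B ->
  law X A = law Y A /\ law X B = law Y B.
Proof.
move=> IC mA mB AB0 qA qB qAB pA pB pAB.
have [s0 [s1 [s2 Hs]]] := IC_r_quad IC mA mB AB0.
move: (law X A) (law X B) (law Y A) (law Y B) qA qB qAB pA pB pAB Hs.
move=> p1 p2 q1 q2 qA qB qAB pA pB pAB Hs.
have r20 : r ^+ 2 != 0 by rewrite sqrf_eq0.
have b2 : 0 < q2 * (1 - q2) by rewrite mulr_gt0//; lra_clear.
(* The gap between the two sides is four times the product of the three cell masses of [Y]. *)
have disc : (- 2 * q1 * q2) ^+ 2 < 4 * (q1 * (1 - q1)) * (q2 * (1 - q2)).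
  rewrite -subr_gt0.
  have -> : 4 * (q1 * (1 - q1)) * (q2 * (1 - q2)) - (- 2 * q1 * q2) ^+ 2 =
    4 * (q1 * q2 * (1 - (q1 + q2))) by ring.
  by rewrite !mulr_gt0// subr_gt0.
have [|l [e1 e2 e3]] := @quad_sqr_prop _ _ (p1 * (1 - p1)) (- 2 * p1 * p2)
    (p2 * (1 - p2)) _ _ _ s0 s1 s2 r20 b2 disc.
  by move=> t; rewrite Hs mulrA.
apply: (@products_prop_eq _ l _ _ (1 - p1 - p2) _ _ (1 - q1 - q2));
  try lra_clear; by rewrite ?lt_eqF//; lra_clear.
Qed.

(** Moving the rest of [A] into [B] gives the cells [A]&[E] and [B]|[A]\[E], with the same third
    cell as before, so that concentration of either law is ruled out. *)
Lemma law_eq_refine X Y A B E : IC_r P r X Y -> measurable A -> measurable B ->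
  measurable E -> A `&` B = set0 ->
  0 < law Y A -> 0 < law Y B -> law Y A + law Y B < 1 ->
  law X A = law Y A -> law X B = law Y B ->
  law X (A `&` E) = law Y (A `&` E).
Proof.
move=> IC mA mB mE AB0 qA qB qAB pqA pqB.
have [[X2 _] [Y2 _] _ _] := IC.
have mX := Lfun_measurable X2; have mY := Lfun_measurable Y2.
have mAE : measurable (A `&` E) by exact: measurableI.
have mAD : measurable (A `\` E) by exact: measurableD.
have mF : measurable (B `|` A `\` E) by exact: measurableU.
have BAD : B `&` (A `\` E) = set0.
  by rewrite setIDA [B `&` A]setIC AB0 set0D.
have EF0 : (A `&` E) `&` (B `|` A `\` E) = set0.
  rewrite setIUr setIAC AB0 set0I set0U.
  by rewrite setIACA setICr setI0.
have FE Z : measurable_fun setT Z ->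
    law Z (B `|` A `\` E) = law Z B + law Z A - law Z (A `&` E).
  by move=> mZ; rewrite lawU// (law_split mZ mA mE); ring.
have le Z : measurable_fun setT Z -> law Z (A `&` E) <= law Z A.
  by move=> mZ; apply: law_le.
have := (law_ge0 X (A `&` E), law_ge0 Y (A `&` E),
  le X mX, le Y mY, FE X mX, FE Y mY).
move=> [[[[[p0 q0] pA] qA'] FX] FY].
have [qE|qE|qE] := ltgtP 0 (law Y (A `&` E)); last 2 first.
- lra_clear.
(* If only [X] charged the new cell, exchanging [X] and [Y] would force equal masses there; if
   neither does, both masses are 0. *)
- have [pE|pE|pE] := ltgtP 0 (law X (A `&` E)); [|lra_clear|by rewrite -pE -qE].
  have [||||||] := law_eq_cells (IC_r_sym IC) mAE mF EF0; lra_clear.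
- have [||||||] := law_eq_cells IC mAE mF EF0; lra_clear.
Qed.

(** [E] is cut along the three cells, each of which is refined with another cell as its
    companion. *)
Lemma law_eq_all X Y A B E : IC_r P r X Y -> measurable A -> measurable B ->
  measurable E -> A `&` B = set0 ->
  0 < law Y A -> 0 < law Y B -> law Y A + law Y B < 1 ->
  law X A = law Y A -> law X B = law Y B ->
  law X E = law Y E.
Proof.
move=> IC mA mB mE AB0 qA qB qAB pqA pqB.
have [[X2 _] [Y2 _] _ _] := IC.
have mX := Lfun_measurable X2; have mY := Lfun_measurable Y2.
have mAB : measurable (A `|` B) by exact: measurableU.
have mC : measurable (~` (A `|` B)) by exact: measurableC.
have CE Z : measurable_fun setT Z ->
    law Z (~` (A `|` B)) = 1 - (law Z A + law Z B).
  by move=> mZ; rewrite lawC// lawU.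
have BA0 : B `&` A = set0 by rewrite setIC.
have CA0 : ~` (A `|` B) `&` A = set0.
  by rewrite setCU setIAC [~` A `&` A]setIC setICr set0I.
have split Z : measurable_fun setT Z -> law Z E =
    law Z (A `&` E) + law Z (B `&` E) + law Z (~` (A `|` B) `&` E).
  move=> mZ; rewrite (law_split mZ mE mAB) setDE [E `&` ~` _]setIC.
  congr (_ + _); rewrite setIC setIUl lawU//; try exact: measurableI.
  by rewrite setIACA AB0 set0I.
have := (CE X mX, CE Y mY) => -[CX CY].
rewrite !split//; congr (_ + _ + _).
- exact: (@law_eq_refine X Y A B).
- by apply: (@law_eq_refine X Y B A) => //; lra_clear.
- by apply: (@law_eq_refine X Y _ A) => //; lra_clear.
Qed.

(** The half-line above the mean [m] works: if it had mass 0 or 1, then [m - X] or [X - m] would be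
    almost surely nonnegative with mean 0, making [X] constant. *)
Lemma nondegenerate_split X : L2 P X ->
  exists B, [/\ measurable B, 0 < law X B & law X B < 1].
Proof.
move=> [X2 ndX]; have mX := Lfun_measurable X2.
have X1 := Lfun_subset12 Pfin X2.
have EX := expectation_fin_num X1.
pose m := fine 'E_P[X]%E.
have cst1 : cst m \in Lfun P 1 by exact: Lfun_cst.
have mB : measurable (`]m, +oo[%classic : set R) by exact: measurable_itv.
have sub_eq0 U V : [set w | (U \- V) w = 0] = [set w | U w = V w].
  by apply/seteqP; split=> w /=; [move/eqP; rewrite subr_eq0 => /eqP|
    move=> ->; rewrite subrr].
exists `]m, +oo[%classic; split => //.
  rewrite lt_neqAle law_ge0 andbT; apply/eqP => B0.
  apply: (ndX m); rewrite (_ : [set w | X w = m] = [set w | m = X w]);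
    last first.
    by apply/seteqP; split=> w /=.
  rewrite -(sub_eq0 (cst m)) expectation_eq0_prob1//.
  - exact: rpredB.
  - by rewrite expectationB// expectation_cst fineK// subee.
  - have -> : [set w | (cst m \- X) w < 0] = X @^-1` `]m, +oo[.
      by apply/seteqP; split=> w /=; rewrite in_itv/= andbT subr_lt0.
    by rewrite -lawE// -B0.
rewrite ltNge; apply/negP => B1.
apply: (ndX m); rewrite -(sub_eq0 X (cst m)) expectation_eq0_prob1//.
- exact: rpredB.
- by rewrite expectationB// expectation_cst fineK// subee.
- have -> : [set w | (X \- cst m) w < 0] = X @^-1` `]-oo, m[.
    by apply/seteqP; split=> w /=; rewrite in_itv/= subr_lt0.
  have mD : measurable (`]-oo, m[%classic : set R) by exact: measurable_itv.
  have mCB : measurable (~` `]m, +oo[%classic : set R) by exact: measurableC.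
  have C0 : law X (~` `]m, +oo[) = 0.
    by apply/eqP; rewrite eq_le law_ge0 lawC// subr_le0 B1.
  rewrite -lawE//; congr (_%:E).
  apply/eqP; rewrite eq_le law_ge0 andbT -C0 law_le//.
  by move=> x /=; rewrite !in_itv/= andbT => xm; apply/negP; rewrite -leNgt ltW.
Qed.

(** If [X] lived on [A], a set [D] splitting its law would cut [A] into two pieces, each of [X]-mass
    strictly between 0 and 1. [Y] charges one of them, and that piece together with [B] gives the
    contradiction. *)
Lemma law_lt1 X Y A B : IC_r P r X Y -> measurable A -> measurable B ->
  A `&` B = set0 ->
  0 < law Y A -> 0 < law Y B -> law Y A + law Y B < 1 -> law X A < 1.
Proof.
move=> IC mA mB AB0 qA qB qAB.
have [LX [Y2 _] _ _] := IC; have [X2 _] := LX.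
have mX := Lfun_measurable X2; have mY := Lfun_measurable Y2.
rewrite ltNge; apply/negP => pA.
have [D [mD pD0 pD1]] := nondegenerate_split LX.
(* [law X B = 0 < law Y B] contradicts [law_eq_cells] for the cells [G], [B]. *)
have step G : measurable G -> G `<=` A -> 0 < law Y G -> 0 < law X G ->
    law X G < 1 -> False.
  move=> mG GA qG pG0 pG1.
  have qGA := law_le mY mG mA GA.
  have GB0 : G `&` B = set0 by rewrite -(setIidl GA) -setIA AB0 setI0.
  have pB : law X B = 0.
    have mAB : measurable (A `|` B) by exact: measurableU.
    have := law_ge0 X (~` (A `|` B)); rewrite lawC// lawU// => h.
    by have := law_ge0 X B; lra_clear.
  by have [||||||pqG pqB] := law_eq_cells IC mG mB GB0; lra_clear.
have mAD : measurable (A `&` D) by exact: measurableI.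
have mAD' : measurable (A `\` D) by exact: measurableD.
have := (law_split mX mA mD, law_split mY mA mD) => -[sX sY].
have pA1 : law X A = 1.
  by have := law_ge0 X (~` A); rewrite lawC// => h; lra_clear.
(* Outside [A] there is no [X]-mass, so intersecting [D] with [A] loses none. *)
have pAD : law X (A `&` D) = law X D.
  have mDA : measurable (D `\` A) by exact: measurableD.
  have mCA : measurable (~` A) by exact: measurableC.
  have : law X (D `\` A) <= law X (~` A).
    by apply: law_le => // x [].
  rewrite (law_split mX mD mA) [D `&` A]setIC lawC// => h.
  by have := law_ge0 X (D `\` A); lra_clear.
have [qD|qD] := ltP 0 (law Y (A `&` D)).
  by apply: (step _ mAD) => //; lra_clear.
by apply: (step _ mAD') => //; lra_clear.
Qed.

(** [law_lt1] applies to each of the three cells; for the complement it yields the positivity of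
    [law X A + law X B] that [law_eq_cells] requires. *)
Lemma law_eq_of_cells X Y A B E : IC_r P r X Y -> measurable A ->
  measurable B -> measurable E -> A `&` B = set0 ->
  0 < law Y A -> 0 < law Y B -> law Y A + law Y B < 1 ->
  law X E = law Y E.
Proof.
move=> IC mA mB mE AB0 qA qB qAB.
have [[X2 _] [Y2 _] _ _] := IC.
have mX := Lfun_measurable X2; have mY := Lfun_measurable Y2.
have mAB : measurable (A `|` B) by exact: measurableU.
have mC : measurable (~` (A `|` B)) by exact: measurableC.
have BA0 : B `&` A = set0 by rewrite setIC.
have CA0 : ~` (A `|` B) `&` A = set0.
  by rewrite setCU setIAC [~` A `&` A]setIC setICr set0I.
have CE Z : measurable_fun setT Z ->
    law Z (~` (A `|` B)) = 1 - (law Z A + law Z B).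
  by move=> mZ; rewrite lawC// lawU.
have pA := law_lt1 IC mA mB AB0 qA qB qAB.
have pB : law X B < 1 by apply: (law_lt1 IC mB mA BA0) => //; lra_clear.
have pC : law X (~` (A `|` B)) < 1.
  by apply: (law_lt1 IC mC mA CA0) => //; rewrite CE//; lra_clear.
rewrite CE// in pC.
have [||||||pqA pqB] := law_eq_cells IC mA mB AB0; [lra_clear..|].
exact: (law_eq_all IC mA mB).
Qed.

End identical_laws.

(** * Charged cells obtained from three points of the support *)

Lemma Supp_gt2_cells Y : measurable_fun setT Y -> card_gt2 (Supp P Y) ->
  exists A B, [/\ measurable A, measurable B, A `&` B = set0 &
    [/\ 0 < law Y A, 0 < law Y B & law Y A + law Y B < 1]].
Proof.
move=> mY [a [b [c [Sa Sb Sc [/eqP ab /eqP bc /eqP ac]]]]].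
(* Half of the least gap serves as the radius: half-open intervals, of the shape used in [Supp], are
   disjoint once their centres are [2 * e] apart. *)
pose m : R := Num.min `|a - b| (Num.min `|b - c| `|a - c|).
have m0 : 0 < m by rewrite !lt_min !normr_gt0 !subr_eq0 ab bc ac.
have [e e0 e2] : exists2 e : R, 0 < e & 2 * e = m.
  by exists (m / 2); [rewrite divr_gt0|rewrite mulrC divfK].
pose I x : set R := `]x - e, x + e]%classic.
have mI x : measurable (I x) by exact: measurable_itv.
have I_gt0 x : Supp P Y x -> 0 < law Y (I x).
  by move=> /(_ e e0) Yx; rewrite -lte_fin lawE.
have disj x y : 2 * e <= `|x - y| -> I x `&` I y = set0.
  move=> xy; apply/seteqP; split=> // z /= -[/andP[z1 z2] /andP[z3 z4]].
  rewrite !bnd_simp in z1 z2 z3 z4.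
  by move: xy; rewrite leNgt ltr_norml => /negP[]; apply/andP;
    split; lra_clear.
have Iab : I a `&` I b = set0 by apply: disj; rewrite e2 !ge_min lexx.
have Ibc : I b `&` I c = set0 by apply: disj; rewrite e2 !ge_min lexx !orbT.
have Iac : I a `&` I c = set0 by apply: disj; rewrite e2 !ge_min lexx !orbT.
exists (I a), (I b); split=> //; split; [exact: I_gt0|exact: I_gt0|].
have mab : measurable (I a `|` I b) by exact: measurableU.
have mabc : measurable ((I a `|` I b) `|` I c) by exact: measurableU.
(* The three disjoint intervals have total mass at most 1 and the one around [c] is charged, so the
   first two leave room. *)
have := law_ge0 Y (~` ((I a `|` I b) `|` I c)).
rewrite lawC// lawU// ?lawU//; last by rewrite setIUl Iac Ibc setU0.
by have := I_gt0 c Sc; lra_clear.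
Qed.

End random_variables.

Theorem theorem2 (d : measure_display) (T : measurableType d) (R : realType)
  (P : probability T R) (X Y : T -> R) :
  atomless P -> L2 P X -> L2 P Y -> diff_distr P X Y ->
  card_gt2 (Supp P Y) ->
  (IC P X Y <-> IC_r P 0 X Y).
Proof.
move=> _ [X2 _] [Y2 _] [E [mE neqE]] cardY.
have mX := Lfun_measurable X2; have mY := Lfun_measurable Y2.
split=> [[r [_ IC]]|IC0]; last by exists 0; rewrite lerN10 ler01.
have [r0|r0] := eqVneq r 0; first by rewrite -r0.
have [A [B [mA mB AB0 [qA qB qAB]]]] := Supp_gt2_cells mY cardY.
(* For nonzero [r] the laws agree on every measurable set, in particular on the set [E] that was
   chosen to separate them. *)
case: neqE; rewrite -!lawE//; congr (_%:E).
exact: (law_eq_of_cells r0 IC mA mB).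
Qed.
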